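(* Let $\mu$ be an ergodic translation-invariant probability measure on $\{0,1\}^{\mathbb{Z}}$ with $p=\mu(\Gamma(0)=1)\in(0,1)$, where $\Gamma$ has law $\mu$. Let $X^{\mathrm{meas}}$ and $X^{\mathrm{walk}}$ be as defined in the context. Then $X^{\mathrm{meas}}$ and $X^{\mathrm{walk}}$ are extra head schemes for $\Gamma$ (in particular they are almost surely finite), and the joint laws of $(X^{\mathrm{meas}},\Gamma)$ and $(X^{\mathrm{walk}},\Gamma)$ are identical.
   Context: For $z\in\mathbb{Z}$ and $\gamma\in\{0,1\}^{\mathbb{Z}}$, $(T^{-z}\gamma)(y)=\gamma(y+z)$; for a measure $\alpha$ on $\{0,1\}^{\mathbb{Z}}$, $T^{z}\alpha$ denotes the push-forward of $\alpha$ under $T^z$. $\mu^*$ denotes the conditional law of $\Gamma$ given $\Gamma(0)=1$. An extra head scheme for $\Gamma$ is a $\mathbb{Z}$-valued random variable $X$ (on some joint probability space with $\Gamma$) such that $T^{-X}\Gamma$ has law $\mu^*$. Definition of $X^{\mathrm{meas}}$. For two measures $\alpha,\beta$ on $\{0,1\}^{\mathbb{Z}}$, $\alpha\wedge\beta$ is the measure whose Radon–Nikodym derivative with respect to $\alpha+\beta$ is the minimum of the Radon–Nikodym derivatives of $\alpha$ and $\beta$ with respect to $\alpha+\beta$. Put $\alpha_0=\mu$, $\beta_0=\mu^*$, and for $n\ge 0$, $$\chi_n=\alpha_n\wedge T^n\beta_n,\qquad \alpha_{n+1}=\alpha_n-\chi_n,\qquad \beta_{n+1}=\beta_n-T^{-n}\chi_n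 .$$ $X^{\mathrm{meas}}$ is a $\{0,1,2,\dots\}\cup\{\infty\}$-valued random variable on a joint probability space with $\Gamma$ such that $\mathbf{P}(X^{\mathrm{meas}}=n,\ \Gamma\in A)=\chi_n(A)$ for all integers $n\ge0$ and all measurable $A\subseteq\{0,1\}^{\mathbb{Z}}$. Definition of $X^{\mathrm{walk}}$. Let $U$ be a Uniform$(0,1)$ random variable independent of $\Gamma$, and put $$X^{\mathrm{walk}}=\min\Big\{n\ge 0:\ \sum_{i=0}^{n}\big(1-p^{-1}\Gamma(i)\big)<U\Big\}$$ (with $\min\emptyset=\infty$). *)

(* Defs.v *)
From HB Require Import structures.
From mathcomp Require Import all_boot all_order all_algebra.
From mathcomp Require Import all_classical all_reals all_analysis.
From mathcomp Require Import measurable_realfun.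

Set Implicit Arguments.
Unset Strict Implicit.
Unset Printing Implicit Defensive.

Import Order.TTheory GRing.Theory Num.Theory.
Import numFieldNormedType.Exports.

Local Open Scope classical_set_scope.
Local Open Scope ring_scope.

(* {0,1}^Z with its product sigma-algebra, generated by the coordinate maps. *)
Definition cylinders : set (set (int -> bool)) :=
  \bigcup_(z : int) preimage_set_system setT (fun g : int -> bool => g z)
                                        measurable.

Definition config := g_sigma_algebraType cylinders.

HB.instance Definition _ := Measurable.on config.

Definition transl (z : int) (g : config) : config := fun y => g (y - z).

Lemma measurable_transl (z : int) : measurable_fun setT (transl z).
Proof.
apply: (@measurability _ _ config config setT _ cylinders) => //.
move=> _ [_ [y _ [B mB <-]] <-].
apply: sub_sigma_algebra; exists (y - z) => //.
by exists B => //; rewrite !setTI.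
Qed.

HB.instance Definition _ z :=
  isMeasurableFun.Build _ _ _ _ (transl z) (measurable_transl z).

(* {0,1,2,...} u {oo}, with None for oo. *)
Definition extnat := option nat.

HB.instance Definition _ := Choice.on extnat.
HB.instance Definition _ := Pointed.on extnat.
HB.instance Definition _ := @isMeasurable.Build default_measure_display
  extnat discrete_measurable discrete_measurable0
  discrete_measurableC discrete_measurableU.

Section finite_measures.
Context d (T : measurableType d) (R : realType).
Implicit Types a b c : {finite_measure set T -> \bar R}.
Local Open Scope ereal_scope.

Section add.
Variables a b : {finite_measure set T -> \bar R}.

Definition fmadd : set T -> \bar R := measure_add a b.

HB.instance Definition _ := Measure.on fmadd.

Let fmadd_fin : fin_num_fun fmadd.
Proof.
move=> A mA; rewrite /fmadd measure_addE.
by rewrite fin_numD !fin_num_measure.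
Qed.

HB.instance Definition _ := Measure_isFinite.Build _ _ _ fmadd fmadd_fin.

Lemma fmaddE A : fmadd A = a A + b A.
Proof. exact: measure_addE. Qed.

End add.

(* Radon_Nikodym_SigmaFinite.f is the everywhere nonnegative and finite version
   of the Radon-Nikodym derivative of a finite measure. *)
Section min.
Variables a b : {finite_measure set T -> \bar R}.

Let rn c := Radon_Nikodym_SigmaFinite.f c (fmadd a b).

Definition fmmin (A : set T) : \bar R :=
  \int[fmadd a b]_(x in A) mine (rn a x) (rn b x).

Let adom : a `<< fmadd a b.
Proof.
apply/null_content_dominatesP => A mA /eqP.
by rewrite /= fmaddE padde_eq0 ?measure_ge0// => /andP[/eqP ->].
Qed.

Let bdom : b `<< fmadd a b.
Proof.
apply/null_content_dominatesP => A mA /eqP.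
by rewrite /= fmaddE padde_eq0 ?measure_ge0// => /andP[_ /eqP ->].
Qed.

Let rna_ge0 x : 0 <= rn a x.
Proof. exact: Radon_Nikodym_SigmaFinite.f_ge0. Qed.

Let rnb_ge0 x : 0 <= rn b x.
Proof. exact: Radon_Nikodym_SigmaFinite.f_ge0. Qed.

Let mrna : measurable_fun setT (rn a).
Proof.
exact: (measurable_int _ (Radon_Nikodym_SigmaFinite.f_integrable _)).
Qed.

Let mrnb : measurable_fun setT (rn b).
Proof.
exact: (measurable_int _ (Radon_Nikodym_SigmaFinite.f_integrable _)).
Qed.

Let min_ge0 x : 0 <= mine (rn a x) (rn b x).
Proof. by rewrite le_min rna_ge0 rnb_ge0. Qed.

Let mmin : measurable_fun setT (fun x => mine (rn a x) (rn b x)).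
Proof. exact: measurable_mine. Qed.

Lemma fmmin_lel A : measurable A -> fmmin A <= a A.
Proof.
move=> mA; rewrite (Radon_Nikodym_SigmaFinite.f_integral adom mA).
apply: ge0_le_integral => //.
- exact: measurable_funTS.
- exact: measurable_funTS.
- by move=> x _; rewrite ge_min lexx.
Qed.

Lemma fmmin_ler A : measurable A -> fmmin A <= b A.
Proof.
move=> mA; rewrite (Radon_Nikodym_SigmaFinite.f_integral bdom mA).
apply: ge0_le_integral => //.
- exact: measurable_funTS.
- exact: measurable_funTS.
- by move=> x _; rewrite ge_min lexx orbT.
Qed.

Let fmmin0 : fmmin set0 = 0.
Proof. exact: integral_set0. Qed.

Let fmmin_ge0 A : 0 <= fmmin A.
Proof. exact: integral_ge0. Qed.

Let fmmin_sigma_additive : semi_sigma_additive fmmin.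
Proof. exact: semi_sigma_additive_nng_induced. Qed.

HB.instance Definition _ := isMeasure.Build _ _ _ fmmin
  fmmin0 fmmin_ge0 fmmin_sigma_additive.

Let fmmin_fin : fin_num_fun fmmin.
Proof.
move=> A mA; rewrite ge0_fin_numE; last exact: measure_ge0.
by rewrite (le_lt_trans (fmmin_lel mA))// ltey_eq fin_num_measure.
Qed.

HB.instance Definition _ := Measure_isFinite.Build _ _ _ fmmin fmmin_fin.

End min.

(* fmsub of a proof of c <= a is a - c.  The library's measures are nonnegative
   on every set, measurable or not, hence the value 0 on nonmeasurable sets. *)
Section sub.
Variables a c : {finite_measure set T -> \bar R}.
Hypothesis ca : forall A, measurable A -> c A <= a A.

Definition fmsub & (forall A, measurable A -> c A <= a A) :=
  fun A : set T => if `[< measurable A >] then a A - c A else 0.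

Local Notation s := (fmsub ca).

Let fmsub0 : s set0 = 0.
Proof. by rewrite /fmsub; case: ifP => // _; rewrite !measure0 subee. Qed.

Let fmsub_ge0 A : 0 <= s A.
Proof.
rewrite /fmsub; case: ifPn => // /asboolP mA.
by rewrite sube_ge0 ?ca// fin_num_measure// orbT.
Qed.

Let fmsub_sigma_additive : semi_sigma_additive s.
Proof.
move=> F mF tF mUF.
have -> : (fun n => \sum_(0 <= i < n) s (F i)) =
  (fun n => \sum_(0 <= i < n) a (F i) - \sum_(0 <= i < n) c (F i)).
  apply/funext => n; rewrite -fin_num_sumeN; last first.
    by move=> i _; rewrite fin_num_measure.
  rewrite -big_split/=; apply: eq_bigr => i _.
  by rewrite /fmsub asboolT.
rewrite /fmsub asboolT//; apply: cvgeB.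
- by rewrite adde_defC fin_num_adde_defl// fin_num_measure.
- exact: measure_semi_sigma_additive.
- exact: measure_semi_sigma_additive.
Qed.

HB.instance Definition _ := isMeasure.Build _ _ _ s
  fmsub0 fmsub_ge0 fmsub_sigma_additive.

Let fmsub_fin : fin_num_fun s.
Proof.
by move=> A mA; rewrite /fmsub asboolT// fin_numB !fin_num_measure.
Qed.

HB.instance Definition _ := Measure_isFinite.Build _ _ _ s fmsub_fin.

End sub.

End finite_measures.

Section transl_measure.
Context (R : realType) (z : int) (a : {finite_measure set config -> \bar R}).
Local Open Scope ereal_scope.

Definition mtransl : set config -> \bar R := pushforward a (transl z).

Let mtransl0 : mtransl set0 = 0.
Proof. by rewrite /mtransl /pushforward preimage_set0 measure0. Qed.

Let mtransl_ge0 A : 0 <= mtransl A. Proof. exact: measure_ge0. Qed.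

Let mtransl_sigma_additive : semi_sigma_additive mtransl.
Proof.
exact: (@measure_semi_sigma_additive _ _ _
  (pushforward a (transl z) : {measure set config -> \bar R})).
Qed.

HB.instance Definition _ := isMeasure.Build _ _ _ mtransl
  mtransl0 mtransl_ge0 mtransl_sigma_additive.

Let mtransl_fin : fin_num_fun mtransl.
Proof.
move=> A mA; rewrite /mtransl /pushforward fin_num_measure//.
by rewrite -[X in measurable X]setTI; exact: measurable_transl.
Qed.

HB.instance Definition _ := Measure_isFinite.Build _ _ _ mtransl mtransl_fin.

End transl_measure.

Section remove_min.
Context (R : realType) (n : nat) (a b : {finite_measure set config -> \bar R}).
Local Open Scope ereal_scope.

Definition chi_step : {finite_measure set config -> \bar R} :=
  fmmin a (mtransl n%:Z b).

Lemma chi_step_le A : measurable A -> chi_step A <= a A.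
Proof. exact: fmmin_lel. Qed.

Lemma mtransl_chi_step_le A :
  measurable A -> mtransl (- n%:Z) chi_step A <= b A.
Proof.
move=> mA; rewrite /mtransl /pushforward.
have mS : measurable (transl (- n%:Z) @^-1` A).
  by rewrite -[X in measurable X]setTI; exact: measurable_transl.
have AE : transl n%:Z @^-1` (transl (- n%:Z) @^-1` A) = A.
  apply/funext => g; rewrite /preimage/=; congr (A _).
  by apply/funext => y; rewrite /transl opprK addrK.
by rewrite -[in leRHS]AE; exact: (fmmin_ler _ _ mS).
Qed.

End remove_min.

(* The pair (alpha_n, beta_n), starting from (mu, nu). *)
Fixpoint residuals (R : realType) (mu nu : {finite_measure set config -> \bar R})
    (n : nat) : {finite_measure set config -> \bar R} *
                {finite_measure set config -> \bar R} :=
  if n is m.+1 then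
    let: (a, b) := residuals mu nu m in
    ((fmsub (@chi_step_le R m a b) : {finite_measure set config -> \bar R}),
     (fmsub (@mtransl_chi_step_le R m a b) :
        {finite_measure set config -> \bar R}))
  else (mu, nu).

Definition chi (R : realType) (mu nu : {finite_measure set config -> \bar R})
    (n : nat) : {finite_measure set config -> \bar R} :=
  chi_step n (residuals mu nu n).1 (residuals mu nu n).2.

Definition head_event : set config := [set g | g 0 = true].

Lemma measurable_head_event : measurable head_event.
Proof.
apply: sub_sigma_algebra; exists 0 => //.
by exists [set true] => //; rewrite setTI.
Qed.

(* mnormalize falls back on its last argument only when mu head_event = 0. *)
Definition cond_head (R : realType) (mu : probability config R) :
    probability config R :=
  mnormalize (mrestr mu measurable_head_event) mu.

Definition translation_invariant (R : realType) (mu : probability config R) :=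
  forall (z : int) (A : set config), measurable A -> mtransl z mu A = mu A.

Definition ergodic (R : realType) (mu : probability config R) :=
  forall A : set config, measurable A ->
    (forall z : int, transl z @^-1` A = A) -> mu A = 0%E \/ mu A = 1%E.

Section random_variables.
Context d (W : measurableType d) (R : realType) (P : probability W R).

Definition has_law d' (S : measurableType d') (X : {RV P >-> S})
    (m : set S -> \bar R) :=
  forall A, measurable A -> distribution P X A = m A.

Definition independent d1 (S1 : measurableType d1) d2 (S2 : measurableType d2)
    (X : {RV P >-> S1}) (Y : {RV P >-> S2}) :=
  forall A B, measurable A -> measurable B ->
    P (X @^-1` A `&` Y @^-1` B) = (P (X @^-1` A) * P (Y @^-1` B))%E.

Definition extra_head_scheme (mu : probability config R)
    (G : {RV P >-> config}) (X : W -> int) :=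
  (forall B : set int, measurable (X @^-1` B)) /\
  (forall A : set config, measurable A ->
    pushforward P (fun w => transl (- X w) (G w)) A = cond_head mu A).

(* The value of X on the null event X = oo is immaterial. *)
Definition ext_extra_head_scheme (mu : probability config R)
    (G : {RV P >-> config}) (X : W -> extnat) :=
  [/\ measurable_fun setT X,
      {ae P, forall w, X w <> None} &
      extra_head_scheme mu G (fun w => (odflt 0%N (X w))%:Z)].

Definition is_Xmeas (mu : probability config R)
    (G : {RV P >-> config}) (X : {RV P >-> extnat}) :=
  forall (n : nat) (A : set config), measurable A ->
    P (X @^-1` [set Some n] `&` G @^-1` A) = chi mu (cond_head mu) n A.

End random_variables.

Definition min_index (Q : pred nat) : extnat :=
  if pselect (exists n, Q n) is left exQ then Some (ex_minn exQ) else None.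

Definition walk_time (R : realType) (p : R) (g : config) (u : R) : extnat :=
  min_index (fun n =>
    \sum_(0 <= i < n.+1) (1 - p^-1 * (g i%:Z)%:R) < u).

(* Main.v *)
Require Import Defs.
From mathcomp Require Import all_boot all_order all_algebra.
From mathcomp Require Import all_classical all_reals all_analysis.
From mathcomp Require Import measurable_realfun.
From mathcomp Require Import lra.

Import Order.TTheory GRing.Theory Num.Theory.
Import numFieldNormedType.Exports.

Local Open Scope classical_set_scope.
Local Open Scope ring_scope.

(** Write W_n for the sum of 1 - g(i)/p over 0 <= i < n, and M_n for the minimum
    of 1 and of W_1, ..., W_n.  Given Gamma = g, the walk stops at time n
    exactly when M_{n+1} < U <= M_n, hence with probability
    M_n^+ - M_{n+1}^+, where x^+ = max(x, 0).

    The same density governs chi_n.  By induction on n, with respect to mu,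
    alpha_n has density M_n^+ and T^n beta_n has density M_n - M_{n+1}
    ([residuals_density]).  Since min(M_n^+, M_n - M_{n+1}) = M_n^+ - M_{n+1}^+
    ([minB_walk_min]), chi_n has density M_n^+ - M_{n+1}^+, and the induction
    step for alpha is immediate.  The step for beta is the identity
    M_{n+1}(g) = W_1(g) + min(M_n(T^{-1} g), 0) ([walk_minS]) together with the
    invariance of mu.  So X^walk satisfies the equations that define X^meas
    ([walk_time_chi]).

    All the conclusions follow once the total mass of beta_n tends to
    0: the telescoping sum of the T^{-n} chi_n is then beta_0 = mu^*
    ([series_chi]), which says at once that X is almost surely finite and that
    T^{-X} Gamma has law mu^*; and a random variable which is almost surely
    finite has its joint law with Gamma determined by the chi_n
    ([joint_lawE]).

    No ergodic theorem is needed for the mass of beta_n.  The event that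
    (M_n)_n is bounded below is translation invariant, so it has probability 0
    or 1.  If it has probability 0, then M_n^+ is eventually 0 almost surely
    and the mass of alpha_n tends to 0; but alpha_n and beta_n have the same
    mass.  If it has probability 1, then M_n converges almost surely, so that
    M_n - M_{n+1}, which lies between 0 and 1/p, tends to 0 almost surely, and
    the mass of beta_n tends to 0.  Dominated convergence applies in both
    cases ([residuals_mass_cvg0]). *)

(** * The minimum of two measures with densities *)

Section minimum_of_densities.
Context {d : measure_display} {T : measurableType d} {R : realType}.
Local Open Scope ereal_scope.

(** If f m = f' m' and h m = h' m' as measures, then min(f, h) m is at most
    min(f', h') m': the measure min(f', h') m' is f' m' where f' <= h' and is
    h' m' elsewhere.  By symmetry the two measures are equal, so the minimum of
    two measures does not depend on the reference measure. *)
Lemma integral_mine_le (m m' : {measure set T -> \bar R})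
    (f h f' h' : T -> \bar R) :
  measurable_fun setT f -> measurable_fun setT h ->
  measurable_fun setT f' -> measurable_fun setT h' ->
  (forall x, 0 <= f x) -> (forall x, 0 <= h x) ->
  (forall x, 0 <= f' x) -> (forall x, 0 <= h' x) ->
  (forall A, measurable A -> \int[m]_(x in A) f x = \int[m']_(x in A) f' x) ->
  (forall A, measurable A -> \int[m]_(x in A) h x = \int[m']_(x in A) h' x) ->
  forall A, measurable A ->
    \int[m]_(x in A) mine (f x) (h x) <= \int[m']_(x in A) mine (f' x) (h' x).
Proof.
move=> mf mh mf' mh' f0 h0 f'0 h'0 ff' hh' A mA.
pose N := [set x | f' x <= h' x].
have mN : measurable N.
  by rewrite -[N]setTI; exact: emeasurable_fun_le.
have mAN : measurable (A `&` N) by exact: measurableI.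
have mAD : measurable (A `\` N) by exact: measurableD.
have AE : A = (A `&` N) `|` (A `\` N).
  by rewrite setUC setDE -setIUr setvU setIT.
have dAN : [disjoint (A `&` N) & (A `\` N)].
  by apply/disj_setPS => x [[_ Nx] [_ /(_ Nx)]].
have mmin : measurable_fun setT (fun x => mine (f x) (h x)).
  exact: measurable_mine.
have mmin' : measurable_fun setT (fun x => mine (f' x) (h' x)).
  exact: measurable_mine.
rewrite AE !ge0_integral_setU//; last 4 first.
- exact: measurable_funTS.
- by move=> x _; rewrite le_min f'0 h'0.
- exact: measurable_funTS.
- by move=> x _; rewrite le_min f0 h0.
apply: leeD.
- rewrite [leRHS](_ : _ = \int[m']_(x in A `&` N) f' x); last first.
    by apply: eq_integral => x /set_mem[_ Nx]; exact/min_idPl.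
  rewrite -ff'//; apply: ge0_le_integral => //.
  + by move=> x _; rewrite le_min f0 h0.
  + exact: measurable_funTS.
  + exact: measurable_funTS.
  + by move=> x _; rewrite ge_min lexx.
- rewrite [leRHS](_ : _ = \int[m']_(x in A `\` N) h' x); last first.
    apply: eq_integral => x /set_mem[_ /negP]; rewrite -ltNge => /ltW Nx.
    exact/min_idPr.
  rewrite -hh'//; apply: ge0_le_integral => //.
  + by move=> x _; rewrite le_min f0 h0.
  + exact: measurable_funTS.
  + exact: measurable_funTS.
  + by move=> x _; rewrite ge_min lexx orbT.
Qed.

Lemma fmmin_density (a b : {finite_measure set T -> \bar R})
    (m : {measure set T -> \bar R}) (f h : T -> \bar R) :
  measurable_fun setT f -> measurable_fun setT h ->
  (forall x, 0 <= f x) -> (forall x, 0 <= h x) ->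
  (forall A, measurable A -> a A = \int[m]_(x in A) f x) ->
  (forall A, measurable A -> b A = \int[m]_(x in A) h x) ->
  forall A, measurable A -> fmmin a b A = \int[m]_(x in A) mine (f x) (h x).
Proof.
move=> mf mh f0 h0 af bh A mA.
have adom : a `<< fmadd a b.
  apply/null_content_dominatesP => B mB /eqP.
  by rewrite /= fmaddE padde_eq0 ?measure_ge0// => /andP[/eqP ->].
have bdom : b `<< fmadd a b.
  apply/null_content_dominatesP => B mB /eqP.
  by rewrite /= fmaddE padde_eq0 ?measure_ge0// => /andP[_ /eqP ->].
have mrn (c : {finite_measure set T -> \bar R}) : c `<< fmadd a b ->
    measurable_fun setT (Radon_Nikodym_SigmaFinite.f c (fmadd a b)).
  move=> cdom.
  exact: (measurable_int _ (Radon_Nikodym_SigmaFinite.f_integrable _)).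
have rn0 (c : {finite_measure set T -> \bar R}) : c `<< fmadd a b ->
    forall x, 0 <= Radon_Nikodym_SigmaFinite.f c (fmadd a b) x.
  by move=> cdom x; exact: Radon_Nikodym_SigmaFinite.f_ge0.
rewrite /fmmin; apply/eqP; rewrite eq_le; apply/andP; split;
  apply: integral_mine_le => //; (do ?[exact: mrn|exact: rn0]) => B mB.
- by rewrite -(Radon_Nikodym_SigmaFinite.f_integral adom mB) af.
- by rewrite -(Radon_Nikodym_SigmaFinite.f_integral bdom mB) bh.
- by rewrite -(Radon_Nikodym_SigmaFinite.f_integral adom mB) af.
- by rewrite -(Radon_Nikodym_SigmaFinite.f_integral bdom mB) bh.
Qed.

End minimum_of_densities.

(** * The walk and its running minimum *)

Section walk.
Context {R : realType} (p : R).
Implicit Types (g : config) (n : nat).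

(** The walk W_n, with W_0 = 0; the sum defining X^walk is W_{n+1}. *)
Definition walk_sum n g : R :=
  \sum_(0 <= i < n) (1 - p^-1 * (g i%:Z)%:R).

(** The running minimum M_n of 1, W_1, ..., W_n.  It starts from M_0 = 1,
    which bounds U from above, and leaves out W_0 = 0. *)
Fixpoint walk_min n g : R :=
  if n is m.+1 then Num.min (walk_min m g) (walk_sum m.+1 g) else 1.

(** The positive part of M_n. *)
Definition walk_minp n g : R := Num.max (walk_min n g) 0.

Lemma walk_sumS n g :
  walk_sum n.+1 g = walk_sum 1 g + walk_sum n (transl (-1) g).
Proof.
rewrite /walk_sum big_nat_recl// big_nat1; congr (_ + _).
apply: eq_bigr => i _; congr (1 - p^-1 * (g _)%:R).
by rewrite opprK -addn1.
Qed.

(** Here [transl (-1) g] is g read from position 1 onwards. *)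
Lemma walk_minS n g : 0 < p ->
  walk_min n.+1 g = walk_sum 1 g + Num.min (walk_min n (transl (-1) g)) 0.
Proof.
move=> p0; elim: n => [|n IHn].
  rewrite /= min_r; first by rewrite min_r ?ler01// addr0.
  rewrite /walk_sum big_nat1 gerBl mulr_ge0// ?invr_ge0; exact: ltW.
rewrite [LHS]/= -/(walk_min n.+1 g) IHn (walk_sumS n.+1) /=.
by rewrite -addr_minr minAC.
Qed.

Lemma walk_min_decr n g : walk_min n.+1 g <= walk_min n g.
Proof. by rewrite /= ge_min lexx. Qed.

Lemma walk_min_le m n g : (m <= n)%N -> walk_min n g <= walk_min m g.
Proof.
elim: n => [|n IHn]; first by rewrite leqn0 => /eqP ->.
rewrite leq_eqVlt => /predU1P[-> //|mn].
exact: le_trans (walk_min_decr n g) (IHn mn).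
Qed.

Lemma walk_min_le1 n g : walk_min n g <= 1.
Proof. by elim: n => //= n IHn; rewrite ge_min IHn. Qed.

Lemma walk_min0B g : 0 < p -> walk_min 0 g - walk_min 1 g = p^-1 * (g 0)%:R.
Proof.
move=> p0; rewrite walk_minS// /= min_r// addr0 /walk_sum big_nat1.
by rewrite opprB addrC subrK.
Qed.

Lemma walk_minB_le n g : 0 < p -> walk_min n g - walk_min n.+1 g <= p^-1.
Proof.
move=> p0; elim: n g => [|n IHn] g.
  by rewrite walk_min0B// ler_piMr ?invr_ge0 ?(ltW p0)//; case: (g _).
rewrite (walk_minS n)// (walk_minS n.+1)//.
have := IHn (transl (-1) g); have := walk_min_decr n (transl (-1) g).
move: (walk_min n _) (walk_min n.+1 _) => x y.
by rewrite !minEle; case: (leP x 0); case: (leP y 0) => *; lra.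
Qed.

Lemma measurable_walk_sum n : measurable_fun setT (walk_sum n).
Proof.
apply: measurable_sum => i.
apply: measurable_funB => //; apply: measurable_funM => //.
have mc : measurable_fun setT (fun g : config => g i%:Z).
  move=> _ B mB; rewrite setTI; apply: sub_sigma_algebra.
  by exists i%:Z => //; exists B => //; rewrite setTI.
have mnat : measurable_fun setT (fun b : bool => b%:R : R) by [].
exact: (measurableT_comp mnat mc).
Qed.

Lemma measurable_walk_min n : measurable_fun setT (walk_min n).
Proof.
elim: n => [|n IHn] /=; first exact: measurable_cst.
by apply: measurable_minr => //; exact: measurable_walk_sum.
Qed.

Lemma walk_minp_ge0 n g : 0 <= walk_minp n g.
Proof. by rewrite le_max lexx orbT. Qed.

Lemma walk_minp_le1 n g : walk_minp n g <= 1.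
Proof. by rewrite ge_max walk_min_le1 ler01. Qed.

Lemma measurable_walk_minp n : measurable_fun setT (walk_minp n).
Proof. by apply: measurable_maxr => //; exact: measurable_walk_min. Qed.

Lemma walk_minp_decr n g : walk_minp n.+1 g <= walk_minp n g.
Proof.
by rewrite ge_max walk_minp_ge0 andbT le_max walk_min_decr.
Qed.

(** The density of chi_n, as the minimum of the densities of alpha_n and of
    T^n beta_n. *)
Lemma minB_walk_min n g :
  Num.min (walk_minp n g) (walk_min n g - walk_min n.+1 g) =
  walk_minp n g - walk_minp n.+1 g.
Proof.
have := walk_min_decr n g; rewrite /walk_minp.
move: (walk_min n g) (walk_min n.+1 g) => x y.
rewrite !maxEle !minEle; case: (leP x 0); case: (leP y 0) => *;
  by case: ifPn => *; lra.
Qed.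

(** The recursion for the density of T^n beta_n. *)
Lemma residual_walk_min n g : 0 < p ->
  let h := transl (-1) g in
  (walk_min n h - walk_min n.+1 h) - (walk_minp n h - walk_minp n.+1 h) =
  walk_min n.+1 g - walk_min n.+2 g.
Proof.
move=> p0 h; rewrite (walk_minS n g)// (walk_minS n.+1 g)// /walk_minp -/h.
move: (walk_min n h) (walk_min n.+1 h) => x y.
by rewrite !maxEle !minEle; case: (leP x 0); case: (leP y 0) => *; lra.
Qed.

Arguments walk_min : simpl never.

Section integrability.
Variable mu : {finite_measure set config -> \bar R}.

Lemma integrable_bounded (f : config -> R) (K : R) (A : set config) :
  measurable A -> measurable_fun setT f -> (forall g, `|f g| <= K) ->
  mu.-integrable A (EFin \o f).
Proof.
move=> mA mf fK; apply: measurable_bounded_integrable => //.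
- by rewrite ltey_eq fin_num_measure.
- exact: measurable_funTS.
- exists K; split; first exact: num_real.
  by move=> y Ky g _; exact: le_trans (fK g) (ltW Ky).
Qed.

Lemma integrable_walk_minp n (A : set config) : measurable A ->
  mu.-integrable A (EFin \o walk_minp n).
Proof.
move=> mA; apply: (@integrable_bounded _ 1) => //.
  exact: measurable_walk_minp.
by move=> g; rewrite ger0_norm ?walk_minp_ge0 ?walk_minp_le1.
Qed.

Lemma integrable_walk_minB n (A : set config) : 0 < p -> measurable A ->
  mu.-integrable A (EFin \o (fun g => walk_min n g - walk_min n.+1 g)).
Proof.
move=> p0 mA; apply: (@integrable_bounded _ p^-1) => //.
  by apply: measurable_funB; exact: measurable_walk_min.
by move=> g; rewrite ger0_norm ?walk_minB_le// subr_ge0 walk_min_decr.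
Qed.

Lemma integrable_walk_minpB n (A : set config) : measurable A ->
  mu.-integrable A (EFin \o (fun g => walk_minp n g - walk_minp n.+1 g)).
Proof.
move=> mA; apply: (@integrable_bounded _ 1) => //.
  by apply: measurable_funB; exact: measurable_walk_minp.
move=> g; rewrite ger0_norm; last by rewrite subr_ge0 walk_minp_decr.
by have := walk_minp_le1 n g; have := walk_minp_ge0 n.+1 g; lra.
Qed.

End integrability.

End walk.
Arguments walk_min : simpl never.

(** * Translations *)

Lemma translK z : cancel (transl z) (transl (- z)).
Proof. by move=> g; apply/funext => y; rewrite /transl opprK addrK. Qed.

Lemma transl_comp z t g : transl z (transl t g) = transl (z + t) g.
Proof.
by apply/funext => y; rewrite /transl opprD addrA.
Qed.

Lemma measurable_transl_preimage z (A : set config) :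
  measurable A -> measurable (transl z @^-1` A).
Proof.
by move=> mA; rewrite -[X in measurable X]setTI; exact: measurable_transl.
Qed.

(** * Densities of the residual measures *)

Section invariant_law.
Context {R : realType} {p : R} {mu : probability config R}.
Hypothesis mu_invariant : translation_invariant mu.
Hypothesis mu_ergodic : ergodic mu.
Hypothesis mu_head : mu head_event = p%:E.
Hypothesis p_gt0 : 0 < p.
Local Open Scope ereal_scope.

Lemma integral_transl z (A : set config) (f : config -> \bar R) :
  measurable A -> measurable_fun setT f -> (forall g, 0 <= f g) ->
  \int[mu]_(g in transl z @^-1` A) f g = \int[mu]_(g in A) f (transl (- z) g).
Proof.
move=> mA mf f0.
rewrite [RHS](eq_measure_integral (pushforward mu (transl z))); last first.
  by move=> B mB _; rewrite -[LHS](mu_invariant z).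
rewrite ge0_integral_pushforward//.
- by apply: eq_integral => g _ /=; rewrite translK.
- by apply: measurable_funTS; apply: measurableT_comp.
Qed.

(** mu^* has density g(0)/p = M_0 - M_1 with respect to mu. *)
Lemma cond_headE (A : set config) : measurable A ->
  cond_head mu A = \int[mu]_(g in A) (walk_min p 0 g - walk_min p 1 g)%:E.
Proof.
move=> mA; pose e := mu ([set: config] `&` head_event).
have eE : e = p%:E by rewrite /e setTI.
rewrite [LHS](_ : _ = if (e == 0) || (e == +oo) then mu A else
  mu (A `&` head_event) * (fine e)^-1%:E); last first.
  by rewrite /cond_head /= /mnormalize; case: ifP.
rewrite eE eqe gt_eqF//=.
rewrite [RHS](_ : _ = \int[mu]_(g in A) (p^-1%:E * (\1_head_event g)%:E)).
  rewrite ge0_integralZl//; last 2 first.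
  - apply/measurable_EFinP; apply: measurable_funTS.
    exact: measurable_indic measurable_head_event.
  - by rewrite lee_fin invr_ge0 ltW.
  have mH := measurable_head_event.
  by rewrite integral_indic// muleC setIC; congr (_ * _).
apply: eq_integral => g _; rewrite -EFinM; congr EFin.
rewrite walk_min0B// indicE; congr (_ * _)%R.
rewrite /head_event; case E : (g 0%R); first by rewrite mem_set.
by rewrite memNset//= E.
Qed.

Lemma chi_step_density n (a b : {finite_measure set config -> \bar R}) :
  (forall A, measurable A -> a A = \int[mu]_(g in A) (walk_minp p n g)%:E) ->
  (forall A, measurable A -> mtransl n%:Z b A =
     \int[mu]_(g in A) (walk_min p n g - walk_min p n.+1 g)%:E) ->
  forall A, measurable A -> chi_step n a b A =
     \int[mu]_(g in A) (walk_minp p n g - walk_minp p n.+1 g)%:E.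
Proof.
move=> aE bE A mA.
rewrite /chi_step /= (fmmin_density a (mtransl n%:Z b) mu
  (EFin \o walk_minp p n)
  (EFin \o (fun g => walk_min p n g - walk_min p n.+1 g)%R))//.
- by apply: eq_integral => g _ /=; rewrite -EFin_min minB_walk_min.
- by apply/measurable_EFinP; exact: measurable_walk_minp.
- by apply/measurable_EFinP; apply: measurable_funB; exact: measurable_walk_min.
- by move=> g /=; rewrite lee_fin walk_minp_ge0.
- by move=> g /=; rewrite lee_fin subr_ge0 walk_min_decr.
Qed.

(** The densities of alpha_n and of T^n beta_n with respect to mu. *)
Lemma residuals_density n :
  (forall A, measurable A -> (residuals mu (cond_head mu) n).1 A =
     \int[mu]_(g in A) (walk_minp p n g)%:E) /\
  (forall A, measurable A -> mtransl n%:Z (residuals mu (cond_head mu) n).2 A =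
     \int[mu]_(g in A) (walk_min p n g - walk_min p n.+1 g)%:E).
Proof.
elim: n => [|n].
  split=> A mA.
    rewrite (eq_integral (cst 1)); last first.
      by move=> g _; rewrite /walk_minp max_l.
    by rewrite integral_cst// mul1e.
  rewrite -cond_headE// /mtransl /pushforward /=; congr (mnormalize _ _ _).
  by apply/funext => g; rewrite /preimage /=; congr (A _); apply/funext => y;
    rewrite /transl subr0.
rewrite /=; case: (residuals mu (cond_head mu) n) => a b /= [aE bE].
have cE := chi_step_density _ _ _ aE bE.
split=> A mA.
  rewrite /fmsub asboolT// aE// cE// -integralB_EFin//.
  - by apply: eq_integral => g _; rewrite -EFinB opprB addrC subrK.
  - exact: integrable_walk_minp.
  - exact: integrable_walk_minpB.
have mA1 : measurable (transl 1 @^-1` A) by exact: measurable_transl_preimage.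
have T1 z t : transl t @^-1` (transl z @^-1` A) = transl (z + t) @^-1` A.
  by apply/funext => g; rewrite /preimage /= transl_comp.
(* T^(n+1) beta_(n+1) = T (T^n beta_n - chi_n). *)
rewrite /mtransl /pushforward /fmsub asboolT; last first.
  exact: measurable_transl_preimage.
rewrite [X in _ - X](_ : _ = chi_step n a b (transl 1 @^-1` A)); last first.
  rewrite -[LHS]/(chi_step n a b
    (transl (- n%:Z)%R @^-1` (transl n.+1%:Z @^-1` A))) T1.
  by rewrite -addn1 PoszD addrC addKr.
rewrite cE//.
have -> : b (transl n.+1%:Z @^-1` A) = mtransl n%:Z b (transl 1 @^-1` A).
  by rewrite /mtransl /pushforward T1 -PoszD.
rewrite bE// -integralB_EFin//; last 2 first.
- exact: integrable_walk_minB.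
- exact: integrable_walk_minpB.
under eq_integral do rewrite -EFinB.
rewrite integral_transl//.
- by apply: eq_integral => g _; rewrite residual_walk_min.
- apply/measurable_EFinP; do !apply: measurable_funB;
    solve [exact: measurable_walk_min|exact: measurable_walk_minp].
- move=> g; rewrite lee_fin -minB_walk_min subr_ge0.
  by rewrite ge_min lexx orbT.
Qed.

Lemma chi_density n (A : set config) : measurable A ->
  chi mu (cond_head mu) n A =
  \int[mu]_(g in A) (walk_minp p n g - walk_minp p n.+1 g)%:E.
Proof. by have [aE bE] := residuals_density n; exact: chi_step_density. Qed.

(** * The residual mass vanishes *)

(** alpha_n and beta_n always have the same total mass, since the same mass is
    removed from both at each step. *)
Lemma residuals_mass n :
  (residuals mu (cond_head mu) n).1 setT =
  (residuals mu (cond_head mu) n).2 setT.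
Proof.
elim: n => [|n].
  by rewrite /= !probability_setT.
rewrite /=; case: (residuals mu (cond_head mu) n) => a b /= abT.
rewrite /fmsub asboolT//; congr (_ - _); exact: abT.
Qed.

(** The event that (M_n)_n is bounded below, that is, inf W_n > -oo. *)
Definition bounded_walk : set config :=
  [set g | exists K : nat, forall n, (- K%:R <= walk_min p n g)%R].

Lemma measurable_bounded_walk : measurable bounded_walk.
Proof.
rewrite (_ : bounded_walk = \bigcup_(K : nat) \bigcap_(n : nat)
  (setT `&` [set g | (cst (- K%:R) g <= walk_min p n g)%R])); last first.
  apply/seteqP; split=> g.
    by move=> [K Kg]; exists K => // n _; split=> //; exact: Kg.
  by move=> [K _ Kg]; exists K => n; have [] := Kg n I.
apply: bigcup_measurable => K _; apply: bigcap_measurable => // n _.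
exact: measurable_fun_le (measurable_cst _) (measurable_walk_min p n).
Qed.

Lemma bounded_walk_transl g : bounded_walk (transl (-1) g) <-> bounded_walk g.
Proof.
split=> [[K gK]|[K gK]].
- (* W_1 >= 1 - 1/p. *)
  exists (K + Num.bound p^-1)%N => -[|n].
    rewrite /walk_min natrD.
    by have := ler0n R K; have := ler0n R (Num.bound p^-1); lra.
  rewrite walk_minS// natrD.
  have := gK n; have pb : (p^-1 < (Num.bound p^-1)%:R)%R.
    by apply: archi_boundP; rewrite invr_ge0 ltW.
  have := walk_minB_le p 0 g p_gt0.
  rewrite walk_minS//= /walk_min min_r// addr0.
  rewrite -/(walk_min p n _) minEle; have := ler0n R K.
  by case: (leP (walk_min p n (transl (-1) g)) 0%R) => *; lra.
- (* W_1 <= 1. *)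
  exists (K + 1)%N => n; rewrite natrD.
  have := gK n.+1; rewrite walk_minS//.
  have := walk_min_decr p 0 g; rewrite walk_minS//= /walk_min min_r// addr0.
  rewrite -/(walk_min p n _) minEle.
  by case: (leP (walk_min p n (transl (-1) g)) 0%R) => *; lra.
Qed.

Lemma bounded_walk_invariant z : transl z @^-1` bounded_walk = bounded_walk.
Proof.
have Tm1 g : bounded_walk (transl (-1) g) = bounded_walk g.
  by apply/propext; exact: bounded_walk_transl.
have Tm (n : nat) g : bounded_walk (transl (- n%:Z) g) = bounded_walk g.
  elim: n g => [|n IHn] g.
    by congr bounded_walk; apply/funext => y; rewrite /transl oppr0 subr0.
  rewrite -addn1 PoszD opprD -transl_comp IHn; exact: Tm1.
apply/funext => g; rewrite /preimage /=.
case: (intP z) => [|n|n] //.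
- exact: (Tm 0%N).
- by rewrite -(Tm n.+1 (transl n.+1%:Z g)) transl_comp addNr (Tm 0%N).
Qed.

Lemma walk_minp_cvg0 g : ~ bounded_walk g ->
  (walk_minp p n g)%:E @[n --> \oo] --> 0.
Proof.
move=> gE; have [N gN] : exists N, (walk_min p N g < 0)%R.
  apply: contrapT => /forallNP g0; apply: gE; exists 0%N => n.
  by rewrite oppr0 leNgt; apply/negP; exact: g0.
apply: cvg_near_cst; exists N => // n /= Nn; congr EFin.
by rewrite /walk_minp max_r// (le_trans (walk_min_le p _ _ g Nn))// ltW.
Qed.

Lemma walk_minB_cvg0 g : bounded_walk g ->
  (walk_min p n g - walk_min p n.+1 g)%:E @[n --> \oo] --> 0.
Proof.
move=> [K gK].
have cv : cvgn (walk_min p ^~ g).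
  apply: nonincreasing_is_cvgn; first by move=> m n; exact: walk_min_le.
  by exists (- K%:R)%R => _ [n _ <-].
apply: cvg_EFin; first exact: nearW.
rewrite -(subrr (limn (walk_min p ^~ g))).
apply: cvgB => //.
by move: cv; rewrite -cvg_shiftS.
Qed.

(** The mass of beta_n is both the integral of M_n^+ and that of
    M_n - M_{n+1}; ergodicity decides which of the two tends to 0 pointwise. *)
Lemma residuals_mass_cvg0 :
  (residuals mu (cond_head mu) n).2 setT @[n --> \oo] --> 0.
Proof.
have mT : measurable [set: config] by [].
have [E0|E1] := mu_ergodic _ measurable_bounded_walk bounded_walk_invariant.
- (* The walk is almost surely unbounded below: pass to the mass of alpha_n. *)
  have -> : (fun n => (residuals mu (cond_head mu) n).2 setT) =
    (fun n => \int[mu]_g (walk_minp p n g)%:E).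
    apply/funext => n; rewrite -residuals_mass.
    by have [-> //] := residuals_density n.
  have := @dominated_convergence _ _ _ mu setT mT
    (fun n => EFin \o walk_minp p n) (cst 0) (cst 1).
  rewrite integral0; case=> //.
  + by move=> n; apply/measurable_EFinP; exact: measurable_walk_minp.
  + exists bounded_walk; split=> //; first exact: measurable_bounded_walk.
    move=> g /=; apply: contra_notP => NE _.
    exact: walk_minp_cvg0.
  + exact: finite_measure_integrable_cst.
  + apply: aeW => g n _ /=.
    by rewrite lee_fin ger0_norm ?walk_minp_ge0 ?walk_minp_le1.
- (* The walk is almost surely bounded below: use the density of T^n beta_n. *)
  have -> : (fun n => (residuals mu (cond_head mu) n).2 setT) =
    (fun n => \int[mu]_g (walk_min p n g - walk_min p n.+1 g)%:E).
    apply/funext => n.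
    by have [_ <- //] := residuals_density n.
  have := @dominated_convergence _ _ _ mu setT mT
    (fun n => EFin \o (fun g => walk_min p n g - walk_min p n.+1 g)%R)
    (cst 0) (cst p^-1%:E).
  rewrite integral0; case=> //.
  + move=> n; apply/measurable_EFinP; apply: measurable_funB;
    exact: measurable_walk_min.
  + exists (~` bounded_walk); split=> //.
    * by apply: measurableC; exact: measurable_bounded_walk.
    * have := probability_setC mu measurable_bounded_walk.
      by rewrite E1 subee.
    apply: subsetC => g gE _ /=.
    exact: walk_minB_cvg0.
  + exact: finite_measure_integrable_cst.
  + apply: aeW => g n _ /=.
    by rewrite lee_fin ger0_norm ?subr_ge0 ?walk_min_decr ?walk_minB_le.
Qed.

(** Partial sums of the T^{-i} chi_i telescope to beta_0 - beta_n. *)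
Lemma sum_chi n (A : set config) : measurable A ->
  \sum_(0 <= i < n) chi mu (cond_head mu) i (transl (- i%:Z) @^-1` A) =
  cond_head mu A - (residuals mu (cond_head mu) n).2 A.
Proof.
move=> mA; elim: n => [|n IHn].
  by rewrite big_nil subee// fin_num_measure.
rewrite big_nat_recr//= IHn /chi.
case: (residuals mu (cond_head mu) n) => a b /=.
rewrite /fmsub asboolT//.
have mA' : measurable (transl (- n%:Z) @^-1` A).
  exact: measurable_transl_preimage.
have kf : chi_step n a b (transl (- n%:Z) @^-1` A) \is a fin_num.
  by rewrite fin_num_measure.
have subA (x y z : \bar R) : z \is a fin_num -> x - y + z = x - (y - z).
  by move=> zf; rewrite fin_num_oppeB// addeA.
exact: subA.
Qed.

(** The measures T^{-n} chi_n sum to mu^*. *)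
Lemma series_chi (A : set config) : measurable A ->
  \sum_(n <oo) chi mu (cond_head mu) n (transl (- n%:Z) @^-1` A) =
  cond_head mu A.
Proof.
move=> mA; apply: cvg_lim => //.
under eq_fun do rewrite sum_chi//.
suff bA0 : (residuals mu (cond_head mu) n).2 A @[n --> \oo] --> 0.
  have cA := cvgeB (fin_num_adde_defl _ _) (cvg_cst (cond_head mu A)) bA0.
  by rewrite sube0 in cA; apply: cA; rewrite fin_numN.
apply: (@squeeze_cvge _ _ _ _ (cst 0) _ _ _ _ (cvg_cst _) residuals_mass_cvg0).
apply: nearW => n; rewrite measure_ge0/=; apply: le_measure => //;
  by rewrite inE.
Qed.

End invariant_law.

(** * Random times whose joint law with Gamma is given by the chi_n *)

Section joint_law.
Context {R : realType} {p : R} {mu : probability config R}.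
Hypothesis mu_invariant : translation_invariant mu.
Hypothesis mu_ergodic : ergodic mu.
Hypothesis mu_head : mu head_event = p%:E.
Hypothesis p_gt0 : (0 < p)%R.
Context {d : measure_display} {W : measurableType d} {P : probability W R}.
Context {G : {RV P >-> config}} {X : W -> extnat}.
Hypothesis mX : measurable_fun setT X.
Hypothesis chiX : forall (n : nat) (A : set config), measurable A ->
  P (X @^-1` [set Some n] `&` G @^-1` A) = chi mu (cond_head mu) n A.
Local Open Scope ereal_scope.

Let F n := X @^-1` [set Some n].

Let mF n : measurable (F n).
Proof. by rewrite -[F n]setTI; exact: mX. Qed.

Let tF : trivIset setT F.
Proof.
apply/trivIsetP => i j _ _ /eqP ij; rewrite -subset0 => w [/= Xi Xj].
by apply: ij; move: Xj; rewrite /F /= Xi => -[].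
Qed.

Let mG A : measurable A -> measurable (G @^-1` A).
Proof. by move=> mA; rewrite -[_ @^-1` _]setTI; exact: measurable_funP. Qed.

(** An event that is determined by Gamma on each event X = n has its
    probability, restricted to X < oo, determined by the chi_n. *)
Lemma finite_part_event (E : set W) (S : nat -> set config) :
  measurable E -> (forall n, measurable (S n)) ->
  (forall n w, X w = Some n -> (E w <-> S n (G w))) ->
  P (E `&` \bigcup_n F n) = \sum_(n <oo) chi mu (cond_head mu) n (S n).
Proof.
move=> mE mS ES; rewrite setI_bigcupr measure_bigcup//; last 2 first.
- by move=> n _; exact: measurableI.
- exact: trivIset_setIl.
rewrite (eq_eseriesl (Q := xpredT)); last by move=> n; rewrite in_setT.
apply: eq_eseriesr => n _; rewrite -chiX//; congr (P _).
by apply/seteqP; split=> w [wE wF]; split=> //; have := ES n w; tauto.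
Qed.

Lemma prob_bigcup_finite : P (\bigcup_n F n) = 1.
Proof.
rewrite -[X in P X]setTI.
rewrite (finite_part_event setT (fun n => transl (- n%:Z) @^-1` setT))//.
  rewrite (series_chi mu_invariant mu_ergodic mu_head p_gt0)//.
  by rewrite probability_setT.
by move=> n; exact: measurable_transl_preimage.
Qed.

Lemma prob_infinite : P (X @^-1` [set None]) = 0.
Proof.
have -> : X @^-1` [set None] = ~` (\bigcup_n F n).
  apply/seteqP; split=> w /=; first by move=> XN [n _]; rewrite /F /= XN.
  by case E: (X w) => [n|] //; case; exists n.
rewrite probability_setC; last exact: bigcup_measurable.
by rewrite [X in _ - X]prob_bigcup_finite subee.
Qed.

(** The restriction to X < oo can be dropped, since X is almost surely
    finite. *)
Lemma prob_event (E : set W) (S : nat -> set config) :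
  measurable E -> (forall n, measurable (S n)) ->
  (forall n w, X w = Some n -> (E w <-> S n (G w))) ->
  P E = \sum_(n <oo) chi mu (cond_head mu) n (S n).
Proof.
move=> mE mS ES; rewrite -(finite_part_event E)//.
have mU : measurable (\bigcup_n F n) by exact: bigcup_measurable.
rewrite (measureDI P mE mU) [X in X + _](_ : _ = 0) ?add0e//.
apply/eqP; rewrite eq_le measure_ge0 andbT.
have <- : P (~` (\bigcup_n F n)) = 0.
  by rewrite probability_setC// [X in _ - X]prob_bigcup_finite subee.
apply: le_measure; rewrite ?inE//.
- exact: measurableD.
- exact: measurableC.
Qed.

Lemma measurable_head_position (B : set int) :
  measurable ((fun w => (odflt 0%N (X w))%:Z) @^-1` B).
Proof.
rewrite (_ : _ @^-1` B = setT `&` X @^-1` [set x | B (odflt 0%N x)%:Z]).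
  exact: mX.
by rewrite setTI.
Qed.

Lemma chi_extra_head : ext_extra_head_scheme mu G X.
Proof.
split=> //.
- exists (X @^-1` [set None]); split.
  + by rewrite -[_ @^-1` _]setTI; exact: mX.
  + exact: prob_infinite.
  + by move=> w /= /contrapT.
- split; first exact: measurable_head_position.
  move=> A mA.
  rewrite -(series_chi mu_invariant mu_ergodic mu_head p_gt0)//.
  apply: prob_event.
  + (* On the null event X = oo the translation is by the default value 0. *)
    pose H x := X @^-1` [set x] `&`
      G @^-1` (transl (- (odflt 0%N x)%:Z)%R @^-1` A).
    have mH x : measurable (H x).
      apply: measurableI; first by rewrite -[_ @^-1` _]setTI; exact: mX.
      by apply: mG; exact: measurable_transl_preimage.
    rewrite (_ : _ @^-1` A = H None `|` \bigcup_n H (Some n)).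
      by apply: measurableU => //; exact: bigcup_measurable.
    apply/seteqP; split=> w /=.
      by case E : (X w) => [n|] /=; [right; exists n => //|left];
        rewrite /H /= E.
    by case=> [[/= -> //]|[n _ [/= -> //]]].
  + by move=> n; exact: measurable_transl_preimage.
  + by move=> n w /= ->.
Qed.

Lemma joint_lawE (B : set (extnat * config)) : measurable B ->
  pushforward P (fun w => (X w, G w)) B =
  \sum_(n <oo) chi mu (cond_head mu) n (xsection B (Some n)).
Proof.
move=> mB; apply: prob_event.
- rewrite -[X in measurable X]setTI.
  by apply: measurable_fun_pair.
- by move=> n; exact: measurable_xsection.
- by move=> n w Xw; rewrite /xsection /= inE /= Xw.
Qed.

End joint_law.

(** * The stopping time X^walk *)

Section walk_time.
Context {R : realType} {p : R}.

Lemma min_indexP (Q : pred nat) n :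
  min_index Q = Some n <-> Q n /\ forall i, (i < n)%N -> ~~ Q i.
Proof.
rewrite /min_index; case: pselect => [exQ|nQ]; last first.
  by split=> // -[Qn _]; case: nQ; exists n.
case: ex_minnP => m Qm mmin; split=> [[<-]|[Qn nQ]].
  by split=> // i; apply: contraTN => /mmin; rewrite -leqNgt.
congr Some; apply/eqP; rewrite eqn_leq mmin// leqNgt.
by apply: contraL Qm => /nQ.
Qed.

Lemma walk_timeP g u n : walk_time p g u = Some n <->
  walk_sum p n.+1 g < u /\ forall i, (i < n)%N -> u <= walk_sum p i.+1 g.
Proof.
rewrite /walk_time min_indexP.
by split=> -[un ui]; split=> // i /ui; rewrite -leNgt.
Qed.

(** The restriction u <= 1 is needed because M_n starts from M_0 = 1. *)
Lemma walk_time_minP g u n : u <= 1 ->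
  walk_time p g u = Some n <-> walk_min p n.+1 g < u <= walk_min p n g.
Proof.
move=> u1.
have leP m : u <= walk_min p m g <->
    forall i, (i < m)%N -> u <= walk_sum p i.+1 g.
  elim: m => [|m IHm]; first by split.
  rewrite /walk_min -/(walk_min p m g) le_min; split.
    by move=> /andP[/IHm um uS] i; rewrite ltnS leq_eqVlt => /predU1P[->//|/um].
  move=> um; apply/andP; split; last exact: um.
  by apply/IHm => i im; apply: um; exact: ltnW.
rewrite walk_timeP -leP; split=> [[Su ->]|/andP[Mu uM]].
  by rewrite andbT; apply: le_lt_trans Su; rewrite ge_min lexx orbT.
split=> //; move: Mu; rewrite /walk_min -/(walk_min p n g) gt_min.
by rewrite ltNge uM.
Qed.

Lemma measurable_walk_time :
  measurable_fun setT (fun x : config * R => walk_time p x.1 x.2).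
Proof.
pose F n := (fun x : config * R => walk_time p x.1 x.2) @^-1` [set Some n].
have msum m : measurable_fun setT (fun x : config * R => walk_sum p m x.1).
  by apply: measurableT_comp => //; exact: measurable_walk_sum.
pose L m := [set x : config * R | x.2 <= walk_sum p m x.1].
have mL m : measurable (L m).
  by rewrite -[L m]setTI; exact: measurable_fun_le.
have mF n : measurable (F n).
  rewrite (_ : F n = ~` L n.+1 `&` \bigcap_(i in [set i | (i < n)%N]) L i.+1).
    apply: measurableI; first exact: measurableC.
    by apply: bigcap_measurableType => i _; exact: mL.
  apply/seteqP; split=> x; rewrite /F /= walk_timeP /L /=.
    by move=> [xn xi]; split; [apply/negP; rewrite -ltNge|exact: xi].
  by move=> [/negP xn xi]; rewrite ltNge.
have mN : measurable
    ((fun x : config * R => walk_time p x.1 x.2) @^-1` [set None]).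
  rewrite (_ : _ @^-1` _ = ~` \bigcup_n F n).
    by apply: measurableC; exact: bigcup_measurable.
  apply/seteqP; split=> x; rewrite /F /=.
    by move=> xN [n _] /=; rewrite xN.
  by case E : (walk_time _ _ _) => [n|] //; case; exists n.
move=> _ B _; rewrite setTI.
rewrite (_ : _ @^-1` B = (if `[< B None >] then
    (fun x : config * R => walk_time p x.1 x.2) @^-1` [set None] else set0) `|`
  \bigcup_(n in [set n | B (Some n)]) F n).
  apply: measurableU; first by case: ifP.
  exact: bigcup_measurable.
apply/seteqP; split=> x /=.
  case E : (walk_time p x.1 x.2) => [n|] Bx; first by right; exists n.
  by left; rewrite asboolT.
case.
  by case: asboolP => [BN /= -> //|].
by case=> n Bn; rewrite /F /= => ->.
Qed.

(** The uniform probability of ]a, b] when a <= b <= 1.  Only the points of the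
    set up to 1 matter, so the set need not be the interval itself. *)
Lemma uniform_prob_itvoc (a b : R) : a <= b -> b <= 1 ->
  forall S : set R, (forall u, u <= 1 -> S u <-> a < u <= b) ->
  uniform_prob (@ltr01 R) S = (Num.max b 0 - Num.max a 0)%:E.
Proof.
move=> ab b1 S SE.
rewrite /uniform_prob integral_uniform_pdf.
rewrite (eq_integral (cst 1%E)); last first.
  move=> x /set_mem[_ /=]; rewrite in_itv /= /uniform_pdf => ->.
  by rewrite subr0 invr1.
have [b0|b0] := ltP b 0.
  rewrite (_ : _ `&` _ = set0).
    by rewrite integral_set0 max_r ?subrr// ltW// (le_lt_trans ab).
  rewrite -subset0 => u [Su]; rewrite /= in_itv/= => /andP[u0 u1].
  by have /andP[_] := (SE u u1).1 Su; lra.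
have [a0|a0] := leP 0 a.
  rewrite (_ : _ `&` _ = `]a, b]%classic); last first.
    apply/seteqP; split=> u.
      by move=> [Su]; rewrite /= !in_itv/= => /andP[u0 u1]; exact/(SE u u1).
    rewrite /= !in_itv/= => /andP[au ub]; have u1 := le_trans ub b1.
    split; first by apply/(SE u u1); rewrite au.
    by rewrite u1 andbT; lra.
  rewrite integral_cst//= mul1e lebesgue_measure_itv/= lte_fin.
  case: ltP => // ba.
  by rewrite (_ : b = a) ?subrr//; apply/eqP; rewrite eq_le ab ba.
rewrite (_ : _ `&` _ = `[0, b]%classic); last first.
  apply/seteqP; split=> u; rewrite /= !in_itv/=.
    by move=> [Su /andP[u0 u1]]; rewrite u0; have /andP[] := (SE u u1).1 Su.
  move=> /andP[u0 ub]; have u1 := le_trans ub b1.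
  split; first by apply/(SE u u1); rewrite ub (lt_le_trans a0).
  by rewrite u0 u1.
rewrite integral_cst//= mul1e lebesgue_measure_itv/= lte_fin.
rewrite subr0 -EFinB subr0; case: ltP => // b0'.
by rewrite (_ : b = 0)//; apply/eqP; rewrite eq_le b0 b0'.
Qed.

Section walk_law.
Context {mu : probability config R}.
Hypothesis mu_invariant : translation_invariant mu.
Hypothesis mu_head : mu head_event = p%:E.
Hypothesis p_gt0 : (0 < p)%R.
Context {d : measure_display} {W : measurableType d} {P : probability W R}.
Context {G : {RV P >-> config}} {U : {RV P >-> R}}.
Hypothesis G_law : has_law G mu.
Hypothesis U_law : has_law U (uniform_prob (@ltr01 R)).
Hypothesis GU : independent G U.
Local Open Scope ereal_scope.

Let X w := walk_time p (G w) (U w).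

Let mpair : measurable_fun setT (fun w => (G w, U w)).
Proof. by apply: measurable_fun_pair. Qed.

Lemma measurable_walk_time_rv : measurable_fun setT X.
Proof. exact: (measurableT_comp measurable_walk_time mpair). Qed.

(** X^walk satisfies the equations that characterize X^meas.  The law of
    (Gamma, U) is a product measure, so that the probability is the integral
    over g of the uniform measure of ]M_{n+1}(g), M_n(g)]. *)
Lemma walk_time_chi n (A : set config) : measurable A ->
  P (X @^-1` [set Some n] `&` G @^-1` A) = chi mu (cond_head mu) n A.
Proof.
move=> mA.
pose C := [set x : config * R | walk_time p x.1 x.2 = Some n] `&` A `*` setT.
have mC : measurable C.
  apply: measurableI; last exact: measurableX.
  rewrite -[X in measurable X]setTI.
  by apply: (measurable_walk_time measurableT [set Some n]).
have := @product_measure_unique _ _ config R R mu (distribution P U)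
  (pushforward P (fun w => (G w, U w)) :
     {measure set (config * R)%type -> \bar R}).
move=> /(_ mpair _ C mC) Cprod.
rewrite [LHS](_ : _ = pushforward P (fun w => (G w, U w)) C); last first.
  rewrite /pushforward; congr (P _); apply/seteqP.
  by split=> w /= [Xw Gw]; split=> //; case: Gw.
rewrite -Cprod; last first.
  move=> B V mB mV; have := GU _ _ mB mV.
  by rewrite [X in X * _](G_law _ mB).
rewrite (chi_density mu_invariant mu_head p_gt0)// [RHS]integral_mkcond.
rewrite /product_measure1; apply: eq_integral => g _ /=.
rewrite /patch; case: ifPn => gA.
  rewrite [LHS]U_law; last exact: measurable_xsection.
  apply: uniform_prob_itvoc.
  - exact: walk_min_decr.
  - exact: walk_min_le1.
  - move=> u u1; rewrite -walk_time_minP// /xsection /= inE /C /=.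
    by split=> [[]//|Xu]; split=> //; split=> //; exact: set_mem.
rewrite (_ : xsection C g = set0) ?measure0//.
rewrite -subset0 => u; rewrite /xsection /= inE /C /= => -[_ [Ag _]].
by move: gA; rewrite mem_set.
Qed.

End walk_law.
End walk_time.

Theorem proposition6 (R : realType) (mu : probability config R) (p : R)
    (mu_invariant : translation_invariant mu) (mu_ergodic : ergodic mu)
    (mu_head : mu head_event = p%:E) (p_gt0 : 0 < p) (p_lt1 : p < 1) :
  [/\ forall (d : measure_display) (W : measurableType d) (P : probability W R)
        (G : {RV P >-> config}) (X : {RV P >-> extnat}),
        has_law G mu -> is_Xmeas mu G X -> ext_extra_head_scheme mu G X,
      forall (d : measure_display) (W : measurableType d) (P : probability W R)
        (G : {RV P >-> config}) (U : {RV P >-> R}),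
        has_law G mu -> has_law U (uniform_prob (@ltr01 R)) ->
        independent G U ->
        ext_extra_head_scheme mu G (fun w => walk_time p (G w) (U w)) &
      forall (d1 d2 : measure_display)
        (W1 : measurableType d1) (P1 : probability W1 R)
        (G1 : {RV P1 >-> config}) (X1 : {RV P1 >-> extnat})
        (W2 : measurableType d2) (P2 : probability W2 R)
        (G2 : {RV P2 >-> config}) (U2 : {RV P2 >-> R}),
        has_law G1 mu -> is_Xmeas mu G1 X1 ->
        has_law G2 mu -> has_law U2 (uniform_prob (@ltr01 R)) ->
        independent G2 U2 ->
        forall B : set (extnat * config), measurable B ->
          pushforward P1 (fun w => (X1 w, G1 w)) B =
          pushforward P2 (fun w => (walk_time p (G2 w) (U2 w), G2 w)) B].
Proof.
split.
- move=> d W P G X _ Xmeas.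
  exact: (chi_extra_head mu_invariant mu_ergodic mu_head p_gt0).
- move=> d W P G U G_law U_law GU.
  apply: (chi_extra_head mu_invariant mu_ergodic mu_head p_gt0).
  + exact: measurable_walk_time_rv.
  + exact: walk_time_chi.
- move=> d1 d2 W1 P1 G1 X1 W2 P2 G2 U2 _ Xmeas G_law U_law GU B mB.
  rewrite (joint_lawE mu_invariant mu_ergodic mu_head p_gt0)//.
  rewrite (joint_lawE mu_invariant mu_ergodic mu_head p_gt0)//.
  + exact: measurable_walk_time_rv.
  + exact: walk_time_chi.
Qed.
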